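(* Let $G$ be a finite $(\delta_1,\delta_2)$-semiregular bipartite simple graph with $\delta_1>\delta_2$, and let $\mathcal{L}(G)$ be its line graph. For every integer $k\in\{2-\delta_1-\delta_2,\dots,\delta_1-\delta_2\}$, $$a_k(\mathcal{L}(G))=\left\lceil\frac{\delta_1+\delta_2+k}{2}\right\rceil .$$
   Context: A graph $G=(V,E)$ is $(\delta_1,\delta_2)$-semiregular bipartite if $V$ can be partitioned into two disjoint (nonempty) subsets $V_1,V_2$ such that every edge joins a vertex of $V_1$ to a vertex of $V_2$, every $v\in V_1$ has degree $\delta_1$, and every $v\in V_2$ has degree $\delta_2$. The line graph $\mathcal{L}(G)$ has the edges of $G$ as vertices, two being adjacent when they are distinct edges sharing an endpoint. For a graph $H$ with vertex set $W$, a set $X\subseteq W$ and $w\in W$, $\delta_X(w)$ denotes the number of neighbors of $w$ in $X$, and $\bar S=W\setminus S$. For an integer $k$, a nonempty set $S\subseteq W$ is a defensive $k$-alliance in $H$ if $\delta_S(w)\ge \delta_{\bar S}(w)+k$ for every $w\in S$. The defensive $k$-alliance number $a_k(H)$ is the minimum cardinality of a defensive $k$-alliance in $H$. *)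

(* Defs.v *)
From mathcomp Require Import all_boot all_order all_algebra.
Set Implicit Arguments.
Unset Strict Implicit.
Unset Printing Implicit Defensive.
Import Order.TTheory GRing.Theory Num.Theory.
Local Open Scope ring_scope.

Record sgraph := SGraph {
  vertex :> finType;
  adj : rel vertex;
  adj_sym : symmetric adj;
  adj_irr : irreflexive adj
}.

Definition deg_in (H : sgraph) (X : {set H}) (w : H) : nat :=
  #|[set x in X | adj w x]|.

Definition deg (H : sgraph) (w : H) : nat := deg_in [set: H] w.

Definition semiregular_bipartite (G : sgraph) (d1 d2 : nat) : Prop :=
  exists V1 V2 : {set G},
    [/\ V1 != set0, V2 != set0, V1 :|: V2 = [set: G] & [disjoint V1 & V2]] /\
    [/\ forall x y : G, adj x y ->
          (x \in V1 /\ y \in V2) \/ (x \in V2 /\ y \in V1),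
        forall v, v \in V1 -> deg v = d1
      & forall v, v \in V2 -> deg v = d2].

Definition edges (G : sgraph) : {set {set G}} :=
  [set e : {set G} | [exists x, exists y, adj x y && (e == [set x; y])]].

Definition edge (G : sgraph) : finType := {e : {set G} | e \in edges G}.

Definition line_adj (G : sgraph) : rel (edge G) :=
  fun e f => (e != f) && (val e :&: val f != set0).

Lemma line_adj_sym (G : sgraph) : symmetric (@line_adj G).
Proof. by move=> e f; rewrite /line_adj eq_sym setIC. Qed.

Lemma line_adj_irr (G : sgraph) : irreflexive (@line_adj G).
Proof. by move=> e; rewrite /line_adj eqxx. Qed.

Definition line_graph (G : sgraph) : sgraph :=
  SGraph (@line_adj_sym G) (@line_adj_irr G).

Definition defensive_alliance (H : sgraph) (k : int) (S : {set H}) : Prop :=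
  S != set0 /\
  forall w, w \in S -> (deg_in (~: S) w)%:Z + k <= (deg_in S w)%:Z.

(* A relation rather than a function: for large k a graph may have no
   defensive k-alliance, and then no n is its k-alliance number. *)
Definition is_alliance_number (H : sgraph) (k : int) (n : nat) : Prop :=
  (exists2 S : {set H}, defensive_alliance k S & #|S| = n) /\
  (forall S : {set H}, defensive_alliance k S -> (n <= #|S|)%N).

Lemma is_alliance_number_uniq (H : sgraph) (k : int) (m n : nat) :
  is_alliance_number H k m -> is_alliance_number H k n -> m = n.
Proof.
move=> [[S aS <-] minS] [[S' aS' <-] minS'].
by apply/eqP; rewrite eqn_leq minS // minS'.
Qed.

(* Main.v *)
Require Import Defs.
From mathcomp Require Import all_boot all_order all_algebra.
From mathcomp Require Import zify lra.
Set Implicit Arguments.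
Unset Strict Implicit.
Unset Printing Implicit Defensive.
Import Order.TTheory GRing.Theory Num.Theory.
Local Open Scope ring_scope.

(** The edge xy of a graph meets [deg x - 1] other edges at x and [deg y - 1]
    other edges at y, and none of them twice since the graph is simple.  The
    line graph of a semiregular bipartite graph is therefore regular, of degree
    D = d1 + d2 - 2 ([line_graph_regular]).

    In a D-regular graph the alliance condition at w says
    2 * deg_S(w) >= D + k, and deg_S(w) <= #|S| - 1, so every defensive
    k-alliance has at least (D + k)/2 + 1 = (d1 + d2 + k)/2 vertices.  A clique
    satisfies deg_S(w) = #|S| - 1, so the bound, rounded up, is attained as soon
    as the graph has a clique that large ([regular_clique_alliance]).  In a line
    graph the edges at a vertex form a clique, and a vertex of the first class
    gives one of size d1.  Since k <= d1 - d2, the required size is at most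
    d1. *)

Lemma deg_in_setC (H : sgraph) (X : {set H}) (w : H) :
  (deg_in X w + deg_in (~: X) w)%N = deg w.
Proof.
rewrite /deg /deg_in -[RHS](cardsID X).
by congr addn; apply: eq_card => x; rewrite !inE andbC.
Qed.

Lemma deg_in_lt (H : sgraph) (X : {set H}) (w : H) :
  w \in X -> (deg_in X w < #|X|)%N.
Proof.
move=> wX; rewrite (cardsD1 w X) wX add1n ltnS; apply/subset_leq_card/subsetP.
move=> x; rewrite !inE => /andP[-> ax]; rewrite andbT.
by apply: contraTneq ax => ->; rewrite adj_irr.
Qed.

Lemma deg_in_clique (H : sgraph) (X : {set H}) (w : H) :
    {in X &, forall u v, u != v -> adj u v} -> w \in X ->
  (deg_in X w).+1 = #|X|.
Proof.
move=> clX wX; rewrite (cardsD1 w X) wX add1n; congr _.+1.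
apply: eq_card => x; rewrite !inE andbC; case xX: (x \in X); rewrite ?andbF //.
rewrite !andbT; have [->|nxw] := eqVneq x w; first exact: adj_irr.
by apply: clX; rewrite // eq_sym.
Qed.

(** The two inequalities on [2 * n] say that n is the least integer with
    (D + 2 + k) / 2 <= n, that is, the lower bound on the size of an alliance
    rounded up. *)
Lemma regular_clique_alliance (H : sgraph) (D n : nat) (k : int) (C : {set H}) :
    (forall w : H, deg w = D) -> {in C &, forall u v, u != v -> adj u v} ->
    (0 < n <= #|C|)%N -> D%:Z + 2 + k <= 2 * n%:Z < D%:Z + 4 + k ->
  is_alliance_number H k n.
Proof.
move=> regH clC /andP[n_gt0 leqnC] /andP[lek ltk].
split=> [|S [/set0Pn[w wS] /(_ w wS)]]; last first.
  by have := deg_in_setC S w; have := deg_in_lt wS; rewrite regH; lia.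
have /card_geqP[s [us sz_s sC]] := leqnC.
have cardS : #|[set x in s]| = n by rewrite cardsE (card_uniqP us).
exists [set x in s] => //; split=> [|w ws]; first by rewrite -card_gt0 cardS.
have clS : {in [set x in s] &, forall u v : H, u != v -> adj u v}.
  by move=> u v; rewrite !inE => /sC uC /sC vC; exact: clC.
have := deg_in_setC [set x in s] w; have := deg_in_clique clS ws.
by rewrite regH cardS; lia.
Qed.

Definition star (G : sgraph) (x : G) : {set line_graph G} :=
  [set e : edge G | x \in val e].

Lemma star_clique (G : sgraph) (x : G) :
  {in star x &, forall e f : line_graph G, e != f -> adj e f}.
Proof.
move=> e f; rewrite !inE => xe xf nef /=; rewrite /line_adj nef /=.
by apply/set0Pn; exists x; rewrite inE xe.
Qed.

Lemma edgeP (G : sgraph) (e : edge G) :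
  exists x y, adj x y /\ val e = [set x; y].
Proof.
have := valP e; rewrite inE => /existsP[x /existsP[y /andP[axy /eqP eE]]].
by exists x, y.
Qed.

Lemma edge_at (G : sgraph) (e : edge G) (x : G) :
  x \in val e -> exists2 y, adj x y & val e = [set x; y].
Proof.
have [u [v [auv ->]]] := edgeP e.
rewrite !inE => /orP[] /eqP->; first by exists v.
by exists u; rewrite 1?adj_sym // setUC.
Qed.

(** Sending an edge at x to its other endpoint is a bijection onto the
    neighbours of x. *)
Lemma card_star (G : sgraph) (x : G) : #|star x| = deg x.
Proof.
rewrite -(card_imset (mem (star x)) val_inj) /deg /deg_in.
rewrite -(card_in_imset (f := fun y => [set x; y])) => [|y z].
  apply: eq_card => A; apply/imsetP/imsetP => [[e]|[y]].
    rewrite inE => /edge_at[y axy eE] ->.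
    by exists y; rewrite // !inE axy.
  rewrite !inE /= => axy ->.
  have xyE : [set x; y] \in edges G.
    by rewrite inE; apply/existsP; exists x; apply/existsP; exists y; rewrite axy /=.
  by exists (exist (fun A => A \in edges G) _ xyE); rewrite // inE set21.
rewrite !inE /= => axy _ /setP/(_ y); rewrite !inE eqxx orbT.
by case: eqP axy => [->|_ _ /esym/eqP //]; rewrite adj_irr.
Qed.

(** The edges meeting e = xy form the union of the stars at x and y, whose
    intersection is e itself: e is lost once to the overlap and once because it
    is not its own neighbour. *)
Lemma deg_line_graph (G : sgraph) (e : line_graph G) (x y : G) :
  adj x y -> val e = [set x; y] -> (deg e + 2 = deg x + deg y)%N.
Proof.
move=> axy eE; have nxy : x != y by apply: contraTneq axy => ->; rewrite adj_irr.
have capE : star x :&: star y = [set e].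
  apply/setP => f; rewrite !inE; apply/andP/eqP => [[xf yf]|->]; last first.
    by rewrite eE !inE !eqxx orbT.
  apply: val_inj; have [z _ fE] := edge_at xf; rewrite fE eE.
  move: yf; rewrite fE !inE [y == x]eq_sym (negPf nxy) /=.
  by move=> /eqP->.
have cupE : [set f in [set: line_graph G] | adj e f] = (star x :|: star y) :\ e.
  apply/setP => f; rewrite !inE /= /line_adj eq_sym; congr (_ && _).
  rewrite eE; apply/set0Pn/orP => [[z]|].
    by rewrite !inE => /andP[/orP[]/eqP-> ->]; [left|right].
  by case=> zf; [exists x|exists y]; rewrite !inE eqxx ?orbT.
rewrite -(card_star x) -(card_star y) -cardsUI capE cards1 /deg /deg_in cupE.
rewrite [in RHS](cardsD1 e) !inE eE !inE eqxx /=; lia.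
Qed.

Lemma line_graph_regular (G : sgraph) (d1 d2 : nat) (e : line_graph G) :
  semiregular_bipartite G d1 d2 -> (deg e + 2 = d1 + d2)%N.
Proof.
move=> [V1 [V2 [_ [bip degV1 degV2]]]].
have [x [y [axy eE]]] := edgeP e; rewrite (deg_line_graph axy eE).
case: (bip x y axy) => -[xV yV]; first by rewrite degV1 // degV2.
by rewrite degV2 // degV1 // addnC.
Qed.

Lemma ceil_half (m : int) :
  m <= 2 * Num.ceil (m%:~R / 2 : rat) < m + 2.
Proof.
have := ceil_itv (m%:~R / 2 : rat); move: (Num.ceil _) => z.
rewrite intrB => /andP[ltz lez].
by apply/andP; split; rewrite -?(ler_int rat) -?(ltr_int rat) ?intrD intrM; lra.
Qed.

Theorem corollary12 (G : sgraph) (d1 d2 : nat)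
    (hG : semiregular_bipartite G d1 d2) (hd : (d2 < d1)%N) (k : int)
    (hk_lo : 2 - d1%:Z - d2%:Z <= k) (hk_hi : k <= d1%:Z - d2%:Z) :
  exists2 n : nat, is_alliance_number (line_graph G) k n &
    n%:Z = Num.ceil ((d1%:Z + d2%:Z + k)%:~R / 2 : rat).
Proof.
set m := d1%:Z + d2%:Z + k; set z := Num.ceil _.
have /andP[lez ltz] : m <= 2 * z < m + 2 := ceil_half m.
have [V1 [V2 [[/set0Pn[v vV1] _ _ _] [_ degV1 _]]]] := hG.
have cardC : #|star v| = d1 by rewrite card_star degV1.
(* As d1 > 0, there is an edge at v; it gives d1 + d2 >= 2, so that the
   truncated difference below is the true one. *)
have /card_gt0P[e _] : (0 < #|star v|)%N by rewrite cardC; lia.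
have regE := line_graph_regular e hG.
exists `|z|%N; last by lia.
apply: (@regular_clique_alliance _ (d1 + d2 - 2) _ _ (star v)).
- by move=> w; have := line_graph_regular w hG; lia.
- exact: star_clique.
- by rewrite cardC; lia.
- by lia.
Qed.
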